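(* For integers $3\le p\le q$, let $FC_{p,q}$ be the graph with $p+q-2$ vertices and $p+q-1$ edges obtained from a cycle $C_p$ (with $p$ vertices and $p$ edges) and a cycle $C_q$ by identifying one edge of $C_p$ with one edge of $C_q$ (so the two cycles share exactly that edge and its two endpoints). Then, writing $\mathcal{G}$ for the Nim value in the game Graph Nimors: $\mathcal{G}(FC_{3,3})=1$; $\mathcal{G}(FC_{3,4})=4$; $\mathcal{G}(FC_{3,q})=2$ for odd $q\ge 5$; $\mathcal{G}(FC_{3,q})=3$ for even $q\ge 6$; and, when $p\ge 4$ and $q\ge 4$, $\mathcal{G}(FC_{p,q})=0$ if $p+q$ is odd and $\mathcal{G}(FC_{p,q})=1$ if $p+q$ is even.
   Context: Graph Nimors is a two-player impartial game played on a finite simple undirected graph. A move consists of either deleting one edge, or contracting one edge $uv$: removing the adjacent vertices $u,v$ and inserting a new vertex $w$ adjacent to every vertex (other than $u,v$) that was adjacent to $u$ or to $v$ (so the result is again simple). Players alternate; when no edges remain no move is possible, and the player who made the last move wins (normal play). Isolated vertices are irrelevant. The options of a graph $G$ are the graphs obtainable from $G$ by one move. For a set $S$ of nonnegative integers, $\mathrm{mex}\,S$ is the least nonnegative integer not in $S$. The Nim value (Sprague–Grundy number) is defined recursively by $\mathcal{G}(G)=\mathrm{mex}\{\mathcal{G}(G'): G' \text{ an option of } G\}$, so a graph with no edges has Nim value $0$. *)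

(* Defs.v *)
From mathcomp Require Import all_boot.
From mathcomp Require Import finmap.
Set Implicit Arguments. Unset Strict Implicit. Unset Printing Implicit Defensive.
Local Open Scope fset_scope.

(* A finite simple graph (without isolated vertices, which are irrelevant in
   Graph Nimors) is represented by its edge set: a finite set of edges, each
   edge being a 2-element set of vertices (vertices are natural numbers). *)
Definition graph := {fset {fset nat}}.

Definition is_simple_graph (G : graph) : bool := [forall e : G, #|` val e| == 2].

Definition vertices (G : graph) : {fset nat} := \bigcup_(e <- G) e.

Definition delete_edge (G : graph) (e : {fset nat}) : graph := G `\ e.

(* contraction of the edge e = {u,v}: u and v are replaced by a fresh vertex w
   adjacent to every other vertex that was adjacent to u or v; loops and
   multiple edges are discarded (edge sets are sets, and edges of size <> 2
   are dropped), so the result is again simple. *)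
Definition fresh_vertex (G : graph) : nat := (\max_(x <- vertices G) x).+1.

Definition contract_edge (G : graph) (e : {fset nat}) : graph :=
  let w := fresh_vertex G in
  let f := fun x : nat => if x \in e then w else x in
  [fset d' in [fset [fset f x | x in (d : {fset nat})] | d in G]
          | #|` (d' : {fset nat})| == 2].

Definition options (G : graph) : seq graph :=
  [seq delete_edge G e | e <- enum_fset G] ++
  [seq contract_edge G e | e <- enum_fset G].

Definition mex (s : seq nat) : nat := find (fun n => n \notin s) (iota 0 (size s).+1).

(* Sprague-Grundy value, defined by recursion with fuel; every move strictly
   decreases the number of edges, so fuel #|` G| suffices. *)
Fixpoint grundy_fuel (k : nat) (G : graph) : nat :=
  match k with
  | 0 => 0
  | k'.+1 => mex [seq grundy_fuel k' H | H <- options G]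
  end.

Definition nim_value (G : graph) : nat := grundy_fuel #|` G| G.

Fixpoint path_edges (x : nat) (l : seq nat) : seq {fset nat} :=
  match l with
  | [::] => [::]
  | y :: l' => [fset x; y] :: path_edges y l'
  end.

Definition cycle_graph (l : seq nat) : graph :=
  match l with
  | [::] => fset0
  | x :: l' => [fset e | e in path_edges x (rcons l' x)]
  end.

Definition FC (p q : nat) : graph :=
  cycle_graph (0 :: 1 :: iota 2 (p - 2)) `|` cycle_graph (0 :: 1 :: iota p (q - 2)).

(* Main.v *)
(* Up to isomorphism only four families of graphs occur below FC_{p,q}, since no
   option of a graph with two independent cycles has both of them and a pendant edge:
   forests, cycles C_k with t further edges attached as leaves (in any order), two cycles
   sharing a vertex, and FC_{p,q} itself.  A forest with n edges has value n mod 2, as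
   every move removes exactly one edge; the other values follow from the recursion, by
   induction on the sizes.  The single mechanism behind all the moves is the "ear", a path
   with fresh internal vertices attached at its ends: deleting one of its edges turns the
   remaining ones into pendant edges, and contracting one shortens the ear by one.
   To avoid quotienting by isomorphism, each family is a predicate closed under
   relabelling vertices injectively. *)
Require Import Defs.
From mathcomp Require Import all_boot.
From mathcomp Require Import finmap.
Set Implicit Arguments. Unset Strict Implicit. Unset Printing Implicit Defensive.
Local Open Scope fset_scope.
Local Open Scope nat_scope.

(** * Least excluded values *)

(** Pigeonhole: the [n] numbers below [n] are distinct members of [s], so [n <= size s] and the
    search over [0, ..., size s] reaches [n]. *)
Lemma mex_eq (s : seq nat) (n : nat) :
  n \notin s -> (forall m, m < n -> m \in s) -> mex s = n.
Proof.
move=> ns lts.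
have ltn : n < (size s).+1.
  have sub : {subset iota 0 n <= s} by move=> m; rewrite mem_iota add0n => /lts.
  by have := uniq_leq_size (iota_uniq 0 n) sub; rewrite size_iota.
rewrite /mex; have -> : (size s).+1 = n + (size s - n).+1 by rewrite addnS subnKC.
rewrite iotaD find_cat size_iota add0n /= ns addn0 ifN //.
by apply/hasPn => m; rewrite mem_iota add0n negbK => /lts.
Qed.

Lemma mexP (s : seq nat) : mex s \notin s /\ forall m, m < mex s -> m \in s.
Proof.
pose k := find (fun n => n \notin s) (iota 0 (size s).+1).
have hs : has (fun n => n \notin s) (iota 0 (size s).+1).
  apply/negPn; apply/hasPn => h.
  have sub : {subset iota 0 (size s).+1 <= s} by move=> m /h; rewrite negbK.
  by have := uniq_leq_size (iota_uniq 0 _) sub; rewrite size_iota ltnn.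
have kE : k < (size s).+1 by have := hs; rewrite has_find size_iota.
split; first by have := nth_find 0 hs; rewrite nth_iota ?add0n.
move=> m mk; have := before_find 0 mk; rewrite nth_iota ?add0n; first by move/negbFE.
exact: ltn_trans mk kE.
Qed.

Lemma mex_ext (s t : seq nat) : s =i t -> mex s = mex t.
Proof.
move=> st; have [nt lt] := mexP t.
by apply: mex_eq => [|m /lt]; rewrite st.
Qed.

(** * Moves lower the number of edges; unfolding the recursion *)

Lemma card_delete (G : graph) e : e \in G -> #|` delete_edge G e| < #|` G|.
Proof. by move=> eG; rewrite /delete_edge (cardfsD1 e G) eG. Qed.

(** No injectivity is built in, so one operation serves for isomorphism and for contraction. *)
Definition relabel (f : nat -> nat) (G : graph) : graph :=
  [fset [fset f x | x in (d : {fset nat})] | d in G].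

Definition identify (e : {fset nat}) (w x : nat) : nat := if x \in e then w else x.

Lemma contract_edge_relabel (G : graph) e :
  contract_edge G e =
  [fset d in relabel (identify e (fresh_vertex G)) G | #|` (d : {fset nat})| == 2].
Proof. by []. Qed.

(** The image of [e] is a singleton, which the size filter drops, so every remaining edge is the
    image of an edge other than [e]. *)
Lemma card_contract (G : graph) e : e \in G -> #|` contract_edge G e| < #|` G|.
Proof.
move=> eG; rewrite contract_edge_relabel.
set f := identify _ _; apply: leq_ltn_trans (card_delete eG).
apply: leq_trans (_ : #|` relabel f (G `\ e)| <= _); last exact: leq_imfset_card.
apply: fsubset_leq_card; apply/fsubsetP => d; rewrite !inE => /andP[].
move=> /imfsetP[d0 /= d0G dE] d2; apply/imfsetP; exists d0 => //=.
rewrite !inE d0G andbT; apply: contraTneq d2 => de; subst d0.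
have : d `<=` [fset fresh_vertex G].
  apply/fsubsetP => y; rewrite dE => /imfsetP[x /= xe ->].
  by rewrite /f /identify xe inE.
by move=> /fsubset_leq_card; rewrite cardfs1; case: #|` d| => [|[|]].
Qed.

Lemma card_options (G H : graph) : H \in options G -> #|` H| < #|` G|.
Proof.
rewrite mem_cat => /orP[] /mapP[e eG ->]; first exact: card_delete.
exact: card_contract.
Qed.

Lemma grundy_fuel_stable k l (G : graph) :
  #|` G| <= k -> #|` G| <= l -> grundy_fuel k G = grundy_fuel l G.
Proof.
have G0 (H : graph) n : #|` H| = 0 -> grundy_fuel n H = 0.
  by move=> /size0nil H0; case: n => //= n; rewrite /options H0.
elim: k l G => [|k IH] [|l] G; rewrite ?leqn0 => Gk Gl.
- by [].
- by rewrite !G0 //; exact/eqP.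
- by rewrite !G0 //; exact/eqP.
rewrite /=; congr mex; apply/eq_in_map => H /card_options HG.
by apply: IH; rewrite -ltnS; apply: leq_trans HG _.
Qed.

Lemma nim_value_mex (G : graph) (s : seq nat) :
  (forall e, e \in G ->
     nim_value (delete_edge G e) \in s /\ nim_value (contract_edge G e) \in s) ->
  (forall m, m \in s -> exists2 e, e \in G &
     nim_value (delete_edge G e) = m \/ nim_value (contract_edge G e) = m) ->
  nim_value G = mex s.
Proof.
move=> Gs sG.
have -> : nim_value G = mex [seq nim_value H | H <- options G].
  (* One extra unit of fuel exposes the [mex] over the options. *)
  rewrite /nim_value (@grundy_fuel_stable _ #|` G|.+1) //=; congr mex.
  by apply/eq_in_map => H /card_options HG; apply: grundy_fuel_stable => //; exact: ltnW.
apply: mex_ext => m; apply/mapP/idP.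
  move=> [H + ->]; rewrite mem_cat => /orP[] /mapP[e eG ->]; by case: (Gs e eG).
move=> /sG[e eG [] <-].
  exists (delete_edge G e) => //; rewrite mem_cat; apply/orP; left.
  by apply/mapP; exists e.
exists (contract_edge G e) => //; rewrite mem_cat; apply/orP; right.
by apply/mapP; exists e.
Qed.

(** * Simple graphs, vertices and relabelling *)

Definition simple (G : graph) : Prop :=
  forall d, d \in G -> exists u v, u != v /\ d = [fset u; v].

Lemma imfset_pair (f : nat -> nat) u v :
  [fset f x | x in [fset u; v]] = [fset f u; f v].
Proof.
apply/fsetP => y; rewrite !inE; apply/imfsetP/orP => [[x /= + ->]|].
  by rewrite !inE => /orP[] /eqP ->; rewrite eqxx; [left|right].
by case=> /eqP ->; [exists u|exists v]; rewrite //= !inE eqxx ?orbT.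
Qed.

Lemma fset2C (u v : nat) : [fset u; v] = [fset v; u].
Proof. by rewrite fsetUC. Qed.

Lemma pair_inj (x a b : nat) : [fset x; a] = [fset x; b] -> a = b.
Proof.
move=> E; have [ax|ax] := eqVneq a x.
  by have := fset22 x b; rewrite -E ax !inE orbb => /eqP.
by have := fset22 x a; rewrite E !inE (negPf ax) => /eqP.
Qed.

Lemma verticesP (G : graph) x :
  reflect (exists2 d, d \in G & x \in d) (x \in vertices G).
Proof.
apply: (iffP (bigfcupP _ _ _ _)) => [[d /andP[dG _] xd]|[d dG xd]]; exists d => //.
by rewrite dG.
Qed.

Lemma vertices_edge u v : vertices [fset [fset u; v]] = [fset u; v].
Proof. by rewrite /vertices big_seq_fset1. Qed.

Lemma verticesU (G H : graph) : vertices (G `|` H) = vertices G `|` vertices H.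
Proof.
apply/fsetP => x; rewrite inE; apply/verticesP/orP.
  move=> [d]; rewrite inE => /orP[] dG xd; [left|right]; by apply/verticesP; exists d.
by case=> /verticesP[d dG xd]; exists d; rewrite ?inE ?dG ?orbT.
Qed.

Lemma vertices0 : vertices fset0 = fset0.
Proof. by rewrite /vertices big_seq_fset0. Qed.

Lemma vertices_delete (G : graph) e : vertices (G `\ e) `<=` vertices G.
Proof.
apply/fsubsetP => x /verticesP[d]; rewrite !inE => /andP[_ dG] xd.
by apply/verticesP; exists d.
Qed.

Lemma relabelU f (G H : graph) : relabel f (G `|` H) = relabel f G `|` relabel f H.
Proof.
apply/fsetP => d; rewrite inE; apply/imfsetP/orP => [[d0 /=]|].
  by rewrite inE => /orP[] d0G ->; [left|right]; apply/imfsetP; exists d0.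
by case=> /imfsetP[d0 /= d0G ->]; exists d0; rewrite //= inE d0G ?orbT.
Qed.

Lemma relabel0 f : relabel f fset0 = fset0.
Proof. by apply/fsetP => d; rewrite inE; apply/imfsetP => -[]. Qed.

Lemma relabel_edge f u v : relabel f [fset [fset u; v]] = [fset [fset f u; f v]].
Proof.
apply/fsetP => d; rewrite inE -imfset_pair; apply/imfsetP/eqP => [[d0 /=]|->].
  by rewrite inE => /eqP -> ->.
by exists [fset u; v] => //=; rewrite inE.
Qed.

Lemma vertices_relabel f (G : graph) y :
  y \in vertices (relabel f G) -> exists2 x, x \in vertices G & y = f x.
Proof.
move=> /verticesP[d /imfsetP[d0 /= d0G ->] /imfsetP[x /= xd ->]].
by exists x => //; apply/verticesP; exists d0.
Qed.

Lemma fresh_vertexN (G : graph) : fresh_vertex G \notin vertices G.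
Proof.
apply/negP => Gw; have := @leq_bigmax_seq _ (enum_fset (vertices G)) xpredT id _ Gw isT.
by rewrite /fresh_vertex ltnn.
Qed.

(** The size filter removes the image of [e] and nothing else: another edge of a simple graph has at
    most one end in [e], and [fresh_vertex G] is not a vertex of [G], so its ends stay distinct. *)
Lemma contract_edgeE (G : graph) e : simple G -> e \in G ->
  contract_edge G e = relabel (identify e (fresh_vertex G)) (delete_edge G e).
Proof.
move=> sG eG; rewrite contract_edge_relabel.
set w := fresh_vertex G; have wG : w \notin vertices G by exact: fresh_vertexN.
have inV x d : d \in G -> x \in d -> x != w.
  by move=> dG xd; apply: contraNneq wG => <-; apply/verticesP; exists d.
apply/fsetP => d; rewrite !inE /=; apply/andP/imfsetP.
  move=> [/imfsetP[d0 /= d0G ->] c2]; exists d0 => //=.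
  rewrite !inE d0G andbT; apply: contraTneq c2 => ->.
  suff -> : [fset identify e w x | x in e] = [fset w] by rewrite cardfs1.
  have [u [v [_ eE]]] := sG e eG; have ue : u \in e by rewrite eE fset21.
  apply/fsetP => y; rewrite inE; apply/imfsetP/eqP => [[x /= xe ->]|->].
    by rewrite /identify xe.
  by exists u; rewrite // /identify ue.
move=> [d0 /=]; rewrite !inE => /andP[d0e d0G] ->; split.
  by apply/imfsetP; exists d0.
have [u [v [uv d0E]]] := sG d0 d0G.
have [a [b [ab eE]]] := sG e eG.
have uw : u != w by apply: (inV _ d0) => //; rewrite d0E fset21.
have vw : v != w by apply: (inV _ d0) => //; rewrite d0E fset22.
rewrite d0E imfset_pair cardfs2 eqSS eqb1 /identify.
case: ifP => ue; case: ifP => ve; rewrite ?(eq_sym w) //.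
(* Both ends of [d0] lie in [e], which would force [d0 = e]. *)
move: d0e ue ve uv; rewrite d0E eE !inE => de.
case/orP => /eqP ?; case/orP => /eqP ?; subst; rewrite ?eqxx // => _.
  by rewrite eqxx in de.
by rewrite fset2C eqxx in de.
Qed.

(** * Walks given by vertex lists *)

(** A cycle is a walk returning to its first vertex, so cycles and ears can be treated alike. *)
Definition pathG (l : seq nat) : graph :=
  if l is x :: l' then [fset e | e in path_edges x l'] else fset0.

Arguments pathG : simpl never.

Lemma cycle_graphE x l : cycle_graph (x :: l) = pathG (x :: rcons l x).
Proof. by []. Qed.

Lemma mem_pathG x l d : (d \in pathG (x :: l)) = (d \in path_edges x l).
Proof. by apply/imfsetP/idP => [[d' /= dl ->]|dl] //; exists d. Qed.

(* Otherwise [inE] sees through [pathG] and exposes the image set. *)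
Opaque pathG.

Lemma pathG1 x : pathG [:: x] = fset0.
Proof. by apply/fsetP => d; rewrite mem_pathG inE. Qed.

Lemma pathG_cons x y l : pathG (x :: y :: l) = [fset [fset x; y]] `|` pathG (y :: l).
Proof. by apply/fsetP => d; rewrite in_fsetU in_fset1 !mem_pathG in_cons. Qed.

Lemma pathG2 x y : pathG [:: x; y] = [fset [fset x; y]].
Proof. by rewrite pathG_cons pathG1 fsetU0. Qed.

Lemma pathG_cat a x b : pathG (a ++ x :: b) = pathG (rcons a x) `|` pathG (x :: b).
Proof.
elim: a => [|y a IH]; first by rewrite pathG1 fset0U.
case: a IH => [|z a] IH; first by rewrite /= !pathG_cons pathG1 fsetU0.
by rewrite !rcons_cons !cat_cons !pathG_cons -rcons_cons -cat_cons IH fsetUA.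
Qed.

Lemma pathG_rev l : pathG (rev l) = pathG l.
Proof.
elim: l => // x [|y l] IH; first by [].
by rewrite rev_cons -cats1 rev_cons cat_rcons pathG_cat -rev_cons IH pathG2
  pathG_cons fsetUC fset2C.
Qed.

Lemma relabel_pathG f l : relabel f (pathG l) = pathG (map f l).
Proof.
elim: l => [|x [|y l] IH]; first exact: relabel0.
  by rewrite /= -/(pathG [:: x]) -/(pathG [:: f x]) !pathG1 relabel0.
by rewrite !map_cons !pathG_cons relabelU relabel_edge IH.
Qed.

Lemma vertices_pathG l x : x \in vertices (pathG l) -> x \in l.
Proof.
elim: l => [|y [|z l] IH]; first by rewrite vertices0.
  by rewrite pathG1 vertices0.
rewrite pathG_cons verticesU vertices_edge !inE => /orP[/orP[]->|/IH]; rewrite ?orbT //.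
by rewrite inE => ->; rewrite orbT.
Qed.

(** * Ears and their edges *)

(** The defaults of [last] and [head] are the ends of the walk, so an empty [A] or [B] covers the
    edge at [x] or at [y]. *)
Lemma pathG_split x A B y :
  pathG (x :: rcons (A ++ B) y) =
  [fset [fset last x A; head y B]] `|` (pathG (x :: A) `|` pathG (rcons B y)).
Proof.
elim: A x => [|a A IH] x /=; last by rewrite !pathG_cons IH fsetUCA -!fsetUA.
by rewrite pathG1 fset0U; case: B => [|b B] /=; rewrite pathG_cons.
Qed.

Lemma pathG_edge x s y e : e \in pathG (x :: rcons s y) ->
  exists A B, s = A ++ B /\ e = [fset last x A; head y B].
Proof.
elim: s x => [|a s IH] x.
  by rewrite pathG2 inE => /eqP ->; exists [::], [::].
rewrite pathG_cons in_fsetU in_fset1 => /orP[/eqP ->|/IH[A [B [-> ->]]]].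
  by exists [::], (a :: s).
by exists (a :: A), B.
Qed.

(* A closed ear ([x = y]) needs two internal vertices, or else its first and last
   edges would coincide. *)
Definition is_ear (x : nat) (s : seq nat) (y : nat) : bool :=
  [&& uniq s, x \notin s, y \notin s & (x == y) ==> (1 < size s)].

Lemma is_ear_rev x s y : is_ear x s y = is_ear y (rev s) x.
Proof. by rewrite /is_ear rev_uniq !mem_rev size_rev eq_sym; congr andb; rewrite andbCA. Qed.

(** If [A] is nonempty, its last vertex is internal and does not recur to the right. If [A] is
    empty, [x] can recur only as [y]; the ear is then closed, the second internal vertex separates
    [head y B] from [x], and the edge still does not recur. *)
Lemma notin_pathG_right x A B y : is_ear x (A ++ B) y ->
  [fset last x A; head y B] \notin pathG (rcons B y).
Proof.
case: B => [|b B]; first by rewrite pathG1.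
rewrite /is_ear => /and4P[us xs ys xy]; apply/negP => eB.
have : last x A \in b :: rcons B y.
  by apply: vertices_pathG; apply/verticesP; exists [fset last x A; b]; rewrite ?fset21.
case/lastP: A us xs ys xy eB => [|A u] us xs ys xy /=; rewrite ?last_rcons => eB.
  move: us xs ys xy; rewrite /= !inE mem_rcons !inE !negb_or => /andP[bB uB] /andP[xb xB] /andP[yb yB].
  rewrite (negPf xb) (negPf xB) orbF /= => + /eqP ?; subst y; rewrite eqxx /=.
  case: B bB uB xB yB eB => // c B; rewrite !in_cons !negb_or => /andP[bc bB] _ /andP[xc _] _ + _.
  rewrite pathG_cons in_fsetU in_fset1 => /orP[/eqP|].
    by rewrite fset2C => /pair_inj /eqP; rewrite (negPf xc).
  move=> e; have : b \in c :: rcons B x.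
    by apply: vertices_pathG; apply/verticesP; exists [fset x; b]; rewrite ?fset22.
  by rewrite inE mem_rcons inE (negPf bc) (negPf bB) eq_sym (negPf xb).
rewrite -rcons_cons mem_rcons inE => /orP[/eqP uy|ub].
  by move: ys; rewrite mem_cat mem_rcons -uy inE eqxx.
by move: us; rewrite cat_uniq => /and3P[_ /hasPn /(_ u ub)]; rewrite mem_rcons inE eqxx.
Qed.

(** This is [notin_pathG_right] for the reversed ear. *)
Lemma notin_pathG_left x A B y : is_ear x (A ++ B) y ->
  [fset last x A; head y B] \notin pathG (x :: A).
Proof.
rewrite is_ear_rev rev_cat => /notin_pathG_right.
rewrite -rev_cons pathG_rev fset2C.
have -> : last y (rev B) = head y B by case: B => //= b B; rewrite rev_cons last_rcons.
by have -> : head x (rev A) = last x A by case/lastP: A => //= A a; rewrite rev_rcons last_rcons.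
Qed.

Lemma delete_pathG x A B y : is_ear x (A ++ B) y ->
  pathG (x :: rcons (A ++ B) y) `\ [fset last x A; head y B] =
  pathG (x :: A) `|` pathG (rcons B y).
Proof.
move=> e; have nl := notin_pathG_left e; have nr := notin_pathG_right e.
rewrite pathG_split; apply/fsetP => d; rewrite in_fsetD1 !in_fsetU in_fset1.
case: eqP => //= ->; by rewrite (negPf nl) (negPf nr).
Qed.

(** This separates the edges of an ear from those of the graph to which it is attached. *)
Lemma ear_internal (x y : nat) A B : A ++ B != [::] ->
  exists2 z, z \in A ++ B & z \in [fset last x A; head y B].
Proof.
case/lastP: A => [|A z] /=; first by case: B => // b B _;
exists b; rewrite ?in_fset2 ?inE ?eqxx ?orbT.
by rewrite last_rcons => _; exists z; rewrite ?mem_cat ?mem_rcons !inE eqxx.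
Qed.

Lemma simple_ear x s y : is_ear x s y -> simple (pathG (x :: rcons s y)).
Proof.
move=> xsy e /pathG_edge[A [B [sE ->]]]; exists (last x A), (head y B); split=> //.
move: xsy; rewrite sE => {sE s}.
case/lastP: A => [|A u]; case: B => [|b B]; rewrite /is_ear => /and4P[us xs ys xy];
rewrite ?last_rcons /=.
- by apply: contraTneq xy => ->; rewrite eqxx.
- by apply: contraNneq xs => ->; rewrite inE eqxx.
- by apply: contraNneq ys => <-; rewrite cats0 mem_rcons inE eqxx.
apply: contraTneq us => ->; rewrite cat_uniq /= mem_rcons inE eqxx /=.
by rewrite andbF.
Qed.

Lemma simpleU G H : simple G -> simple H -> simple (G `|` H).
Proof. by move=> sG sH d; rewrite inE => /orP[/sG|/sH]. Qed.

(** * Pendant edges over a base class *)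

(** The new leaf is [x]. The vertex [y] may be an earlier leaf or lie outside [G], so that pendant
    edges over the edgeless graph yield forests. *)
Inductive pendant (B : graph -> Prop) : nat -> graph -> Prop :=
| pendant0 G : B G -> pendant B 0 G
| pendantS t G x y : pendant B t G -> x \notin vertices G -> x != y ->
    pendant B t.+1 ([fset [fset x; y]] `|` G).

(** Injectivity is asked on the vertices of [G] only: the contraction maps used later are injective
    just there. *)
Definition iso_closed (B : graph -> Prop) : Prop :=
  forall f G, {in vertices G &, injective f} -> B G -> B (relabel f G).

(** Taken from [x] outwards, every edge of the path adds its far end as a new leaf. *)
Lemma pendant_path B t G x l : pendant B t G -> uniq (x :: l) ->
  (forall z, z \in l -> z \notin vertices G) ->
  pendant B (size l + t) (pathG (x :: l) `|` G).
Proof.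
elim: l x t G => [|y l IH] x t G; first by rewrite pathG1 fset0U.
move=> BG; rewrite cons_uniq inE negb_or => /andP[/andP[xy xl] uyl] lG.
rewrite pathG_cons fsetUAC addSnnS fsetUC; apply: IH => //.
  rewrite fset2C; apply: pendantS => //; last by rewrite eq_sym.
  by apply: lG; rewrite inE eqxx.
move=> z zl; rewrite verticesU vertices_edge !inE !negb_or lG ?inE ?zl ?orbT // andbT.
apply/andP; split; first by apply: contraNneq xl => <-.
by move: uyl; rewrite /=; case/andP => yl _; apply: contraNneq yl => <-.
Qed.

(** This absorbs a degenerate base, such as a collapsed cycle, into the count of pendant edges. *)
Lemma pendant_trans (B B' : graph -> Prop) n t G :
  (forall H, B H -> pendant B' n H) -> pendant B t G -> pendant B' (n + t) G.
Proof.
move=> BB'; elim=> {t G} [G /BB'|t G x y _ IH xG xy]; first by rewrite addn0.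
by rewrite addnS; apply: pendantS.
Qed.

Lemma pendant_sub (B B' : graph -> Prop) t G :
  (forall H, B H -> B' H) -> pendant B t G -> pendant B' t G.
Proof. by move=> BB' /(@pendant_trans _ _ 0); apply=> H /BB'; apply: pendant0. Qed.

Lemma in_vertices_relabel (D : {fset nat}) f G x : {in D &, injective f} ->
  vertices G `<=` D -> x \in D -> x \notin vertices G -> f x \notin vertices (relabel f G).
Proof.
move=> fI GD xD; apply: contra => /vertices_relabel[y yG /fI -> //].
exact: (fsubsetP GD).
Qed.

Lemma pendant_closed B t : iso_closed B -> iso_closed (pendant B t).
Proof.
move=> cB f G + BG; elim: BG => {t G} [G BG|t G x y _ IH xG xy] fI.
  by apply: pendant0; apply: cB.
rewrite relabelU relabel_edge.
have GD : vertices G `<=` vertices ([fset [fset x; y]] `|` G).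
  by rewrite verticesU fsubsetUr.
have xD : x \in vertices ([fset [fset x; y]] `|` G).
  by rewrite verticesU vertices_edge !inE eqxx.
have yD : y \in vertices ([fset [fset x; y]] `|` G).
  by rewrite verticesU vertices_edge !inE eqxx orbT.
apply: pendantS; last by rewrite (inj_in_eq fI).
  by apply: IH; apply: sub_in2 fI; exact/fsubsetP.
exact: in_vertices_relabel fI GD _ _.
Qed.

Lemma pendant_simple (B : graph -> Prop) t G :
  (forall H, B H -> simple H) -> pendant B t G -> simple G.
Proof.
move=> sB; elim=> {t G} [G /sB //|t G x y _ sG _ xy].
by apply: simpleU => // d; rewrite inE => /eqP ->; exists x, y.
Qed.

(** At most one vertex of [G] lies in [e], since two of them and [z] would be three elements;
    identifying [e] to the fresh [w] thus only renames it. *)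
Lemma identify_inj (e : {fset nat}) w z G : z \in e -> #|` e| = 2 ->
    z \notin vertices G -> w \notin vertices G ->
  {in vertices G &, injective (identify e w)}.
Proof.
move=> ze e2 zG wG a b aG bG; rewrite /identify.
have eE (x y : nat) : x \in vertices G -> y \in vertices G -> x \in e -> y \in e -> x = y.
  move=> xG yG xe ye; apply/eqP; apply: contraTT (eqxx #|` e|) => xy.
  have : [fset x; y; z] `<=` e.
    by apply/fsubsetP => u; rewrite !inE => /orP[/orP[]|] /eqP ->.
  move/fsubset_leq_card; rewrite fsetUC cardfsU1 cardfs2 e2 xy !inE negb_or.
  have -> : z != x by apply: contraNneq zG => ->.
  by have -> : z != y by apply: contraNneq zG => ->.
case: ifP => ae; case: ifP => be //; first by move=> _; apply: eE.
  by move=> wb; rewrite -wb (negPf wG) in bG.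
by move=> aw; rewrite aw (negPf wG) in aG.
Qed.

(** * Moves in a graph with pendant edges *)

(** The new vertex is a parameter, so that a [w] fresh for the whole graph can also be used for its
    subgraphs in inductions. *)
Definition contract (w : nat) (G : graph) (e : {fset nat}) : graph :=
  relabel (identify e w) (G `\ e).

Lemma delete_add_edge (G : graph) e x y : e \in G -> x \notin vertices G ->
  ([fset [fset x; y]] `|` G) `\ e = [fset [fset x; y]] `|` (G `\ e).
Proof.
move=> eG xG; apply/fsetP => d; rewrite !in_fsetD1 !in_fsetU !in_fset1 in_fsetD1.
case: (eqVneq d e) => //= ->; case: eqP => // exy; case/verticesP: xG.
by exists e; rewrite // exy fset21.
Qed.

(** A move inside [G] commutes with attaching the leaf [x]: it is not an end of [e], so contraction
    leaves it alone and at most moves [y] to [w]. *)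
Lemma pendant_add_edge (B : graph -> Prop) n G e x y w :
  e \in G -> x \notin vertices G -> x != y -> w \notin vertices ([fset [fset x; y]] `|` G) ->
  (pendant B n (G `\ e) -> pendant B n.+1 (([fset [fset x; y]] `|` G) `\ e)) /\
  (pendant B n (contract w G e) -> pendant B n.+1 (contract w ([fset [fset x; y]] `|` G) e)).
Proof.
move=> eG xG xy; rewrite verticesU vertices_edge !inE !negb_or => /andP[/andP[wx wy] wG].
have xe : x \notin e by apply: contra xG => xe; apply/verticesP; exists e.
rewrite /contract delete_add_edge // relabelU relabel_edge; split=> Gn; apply: pendantS => //.
- by apply: contra xG; exact: (fsubsetP (vertices_delete _ _)).
- rewrite /identify (negPf xe); apply/negP => /vertices_relabel[z zG].
  case: ifP => _ ?; subst; first by rewrite eqxx in wx.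
  by move/negP: xG; apply; exact: (fsubsetP (vertices_delete _ _)) zG.
by rewrite /identify (negPf xe); case: ifP => _ //; rewrite eq_sym.
Qed.

Lemma delete_pendant (G : graph) x y : x \notin vertices G ->
  ([fset [fset x; y]] `|` G) `\ [fset x; y] = G.
Proof.
move=> xG; apply/fsetP => d; rewrite in_fsetD1 in_fsetU in_fset1.
case: eqVneq => //= ->; apply/esym/negbTE; apply: contra xG => eG.
by apply/verticesP; exists [fset x; y]; rewrite ?fset21.
Qed.

(** Contracting a pendant edge removes the leaf and at most renames [y] to [w]. *)
Lemma contract_pendant B t G x y w : iso_closed B -> pendant B t G ->
  x \notin vertices G -> x != y -> w \notin vertices G ->
  pendant B t (contract w ([fset [fset x; y]] `|` G) [fset x; y]).
Proof.
move=> cB BG xG xy wG; rewrite /contract delete_pendant //.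
apply: pendant_closed => //; apply: (@identify_inj _ _ x) => //.
  by rewrite fset21.
by rewrite cardfs2 xy.
Qed.

Section PendantOptions.

Variables (B B1 B2 : graph -> Prop) (n1 n2 : nat).
Hypothesis closedB : iso_closed B.
Hypothesis optionsB : forall G e w, B G -> e \in G -> w \notin vertices G ->
  pendant B1 n1 (G `\ e) /\ pendant B2 n2 (contract w G e).

(** A move on the outermost pendant edge costs one leaf; any other move lies in the smaller graph
    and lifts by [pendant_add_edge]. *)
Lemma pendant_options t G e w : pendant B t G -> e \in G -> w \notin vertices G ->
  [/\ 0 < t, pendant B t.-1 (G `\ e) & pendant B t.-1 (contract w G e)] \/
  pendant B1 (n1 + t) (G `\ e) /\ pendant B2 (n2 + t) (contract w G e).
Proof.
elim=> {t G} [G BG eG wG|t G x y BG IH xG xy]; first by right; rewrite !addn0; apply: optionsB.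
rewrite in_fsetU in_fset1 => eG wG; have wG' : w \notin vertices G.
  by move: wG; rewrite verticesU in_fsetU negb_or => /andP[].
case/orP: eG => [/eqP ->|eG].
  by left; rewrite delete_pendant //; split=> //; apply: contract_pendant.
have lift C n := @pendant_add_edge C n _ _ _ _ _ eG xG xy wG.
case: (IH eG wG') => [[t0 Bd Bc]|[Bd Bc]].
  by left; rewrite -(prednK t0); split=> //; apply lift.
by right; rewrite !addnS; split; apply lift.
Qed.

(** With [pendant_leaf_option], this shows that the outcomes allowed by [pendant_options] do
    occur. *)
Lemma pendant_base_option t G : (forall H, B H -> exists e, e \in H) -> pendant B t G ->
  exists2 e, e \in G & forall w, w \notin vertices G ->
    pendant B1 (n1 + t) (G `\ e) /\ pendant B2 (n2 + t) (contract w G e).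
Proof.
move=> neB; elim=> {t G} [G BG|t G x y BG [e eG IH] xG xy].
  have [e eG] := neB G BG; exists e => // w wG; rewrite !addn0.
  exact: optionsB.
exists e => [|w wG]; first by rewrite in_fsetU eG orbT.
have [|Bd Bc] := IH w; first by move: wG; rewrite verticesU in_fsetU negb_or => /andP[].
by rewrite !addnS; split; apply (@pendant_add_edge _ _ _ _ _ _ w).
Qed.

End PendantOptions.

Lemma pendant_leaf_option B t G : pendant B t.+1 G ->
  exists2 e, e \in G & pendant B t (G `\ e).
Proof.
move=> BG; inversion BG as [|t' H x y BH xH xy]; subst.
exists [fset x; y]; first by rewrite in_fsetU in_fset1 eqxx.
by rewrite delete_pendant.
Qed.

(** * Moves on an ear *)

Lemma mem_vertices_pathG l x : 1 < size l -> x \in l -> x \in vertices (pathG l).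
Proof.
elim: l => [|y [|z l] IH] // _; rewrite pathG_cons verticesU vertices_edge in_fsetU => xl.
case: l IH xl => [|a l] IH xl; first by rewrite in_fset2; move: xl; rewrite !inE => ->.
move: xl; rewrite inE => /orP[/eqP ->|xl]; first by rewrite fset21.
by rewrite IH ?orbT.
Qed.

Section Ear.

Variables (x y : nat) (s : seq nat) (H : graph).
Hypotheses (xsy : is_ear x s y) (s0 : s != [::]).
Hypothesis sH : forall z, z \in s -> z \notin vertices H.

Lemma delete_ear e : e \in pathG (x :: rcons s y) ->
  exists A B, [/\ s = A ++ B, e = [fset last x A; head y B] &
    (pathG (x :: rcons s y) `|` H) `\ e = pathG (x :: A) `|` (pathG (rcons B y) `|` H)].
Proof.
move=> /pathG_edge[A [B [sE eE]]]; exists A, B; split=> //.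
rewrite fsetUA -delete_pathG -?sE // -eE; apply/fsetP => d.
rewrite in_fsetD1 !in_fsetU in_fsetD1; case: (eqVneq d e) => //= ->.
(* The edge contains an internal vertex of the ear, hence is not an edge of [H]. *)
have [z zs ze] : exists2 z, z \in s & z \in e.
  by rewrite sE eE; apply: ear_internal; rewrite -sE.
apply/esym/negbTE; apply: contra (sH zs) => eH.
by apply/verticesP; exists e.
Qed.

(** Of the [size s + 1] edges of the ear, [size s] remain. They form two paths, one growing from [x]
    and the other, read backwards, from [y]. *)
Lemma pendant_delete_ear e : e \in pathG (x :: rcons s y) ->
  pendant (eq H) (size s) ((pathG (x :: rcons s y) `|` H) `\ e).
Proof.
move=> /delete_ear[A [B [sE _ ->]]];
have sHAB z : z \in A ++ B -> z \notin vertices H by rewrite -sE; exact: sH.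
move: (xsy); rewrite /is_ear sE => /and4P[us xs ys _].
move: us xs ys; rewrite cat_uniq !mem_cat !negb_or => /and3P[uA /hasPn AB uB] /andP[xA xB] /andP[yA yB].
rewrite size_cat -[pathG (rcons B y)]pathG_rev rev_rcons -(size_rev B) -[_ + size _]addn0 -addnA.
apply: pendant_path => [||z zA]; last first.
- rewrite verticesU in_fsetU negb_or sHAB ?mem_cat ?zA // andbT.
  apply/negP => /vertices_pathG; rewrite inE mem_rev => /orP[/eqP zy|/AB].
    by rewrite -zy zA in yA.
  by rewrite zA.
- by rewrite cons_uniq xA.
apply: pendant_path; first exact: pendant0.
  by rewrite cons_uniq mem_rev yB rev_uniq.
by move=> z; rewrite mem_rev => zB; rewrite sHAB // mem_cat zB orbT.
Qed.

(* The contracted graph is an injective relabelling of the graph with the shorter ear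
   [s'], hence lies in every isomorphism-closed class containing the latter. *)
Lemma contract_ear e w : e \in pathG (x :: rcons s y) ->
  w \notin vertices (pathG (x :: rcons s y) `|` H) ->
  exists s', [/\ (size s').+1 = size s, subseq s' s &
    forall C, iso_closed C -> C (pathG (x :: rcons s' y) `|` H) ->
      C (contract w (pathG (x :: rcons s y) `|` H) e)].
Proof.
move=> eG wG; have [A [B [sE eE dE]]] := delete_ear eG.
pose f := identify e w.
have fu : f (last x A) = w by rewrite /f /identify eE fset21.
have fv : f (head y B) = w by rewrite /f /identify eE fset22.
(* The shorter ear omits an internal vertex [z] of [e], the last of [A] or, if [A] is empty, the
   first of [B]. The other end of [e] stays and is renamed to [w]. *)
have [s' [z [zs' ss' [zs ze] szs relE]]] : exists s' z, [/\ z \notin s', subseq s' s, z \in s /\ z \in e,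
    (size s').+1 = size s &
    relabel f (pathG (x :: A) `|` pathG (rcons B y)) = relabel f (pathG (x :: rcons s' y))].
  have us : uniq (A ++ B) by move: xsy; rewrite sE => /and4P[].
  case/lastP: A {dE} sE eE fu us => [|A z] /= sE eE fu us.
    case: B sE eE fv us => [|z B] sE eE fv us; first by case/negP: s0; rewrite sE.
    exists B, z; rewrite sE /= eE /= in_fset2 inE eqxx orbT; split=> //.
    - by case/andP: us.
    - exact: subseq_cons.
    rewrite relabelU !relabel_pathG pathG1 fset0U /=.
    by rewrite fu -fv.
  exists (A ++ B), z; rewrite sE; split.
  - move: us; rewrite cat_uniq rcons_uniq mem_cat => /and3P[/andP[zA _] /hasPn zB _].
    by rewrite negb_or zA; apply/negP => /zB; rewrite mem_rcons inE eqxx.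
  - by rewrite cat_subseq // subseq_rcons.
  - by rewrite mem_cat mem_rcons inE eqxx eE last_rcons fset21.
  - by rewrite !size_cat size_rcons.
  rewrite relabelU !relabel_pathG.
  have -> : rcons B y = head y B :: behead (rcons B y) by case: (B).
  have -> : rcons (A ++ B) y = A ++ head y B :: behead (rcons B y) by case: (B)
      => [|b B']; rewrite /= -?cats1 -?catA.
  rewrite /= map_cat map_rcons /= -cat_cons pathG_cat -rcons_cons fv.
  by rewrite last_rcons in fu; rewrite fu.
exists s'; split=> // C cC CG.
rewrite /contract dE fsetUA relabelU relE -relabelU; apply: cC => //.
have inV u : u \in vertices (pathG (x :: rcons s' y) `|` H) ->
    u \in x :: rcons s' y \/ u \in vertices H.
  by rewrite verticesU in_fsetU => /orP[/vertices_pathG|]; [left|right].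
apply: (@identify_inj _ _ z) => //.
- have [u [v [uv ->]]] := simple_ear xsy eG.
  by rewrite cardfs2 uv.
- apply/negP => /inV[]; last by rewrite (negPf (sH zs)).
  rewrite inE mem_rcons inE (negPf zs') orbF.
  by move: xsy => /and4P[_ xs ys _] /orP[] /eqP zE; move: xs ys; rewrite -zE zs.
move: wG; rewrite verticesU in_fsetU negb_or => /andP[wG wH].
apply/negP => /inV[]; last by rewrite (negPf wH).
move=> ws'; move/negP: wG; apply; apply: mem_vertices_pathG; first by rewrite /= size_rcons.
move: ws'; rewrite !inE !mem_rcons !inE => /or3P[->|->|/(mem_subseq ss') ->]; rewrite ?orbT //.
Qed.

End Ear.

(** * The families with cycles *)

(* With [k = 2], [a = 2] or [p = 2] a digon collapses to a single edge: [cyc 2] is one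
   edge, [two_cycles 2 b] a cycle with one pendant edge, and [fused 2 q] is [cyc q]. *)
Definition cyc (k : nat) (G : graph) : Prop :=
  exists x s, [/\ uniq (x :: s), (size s).+1 = k & G = pathG (x :: rcons s x)].

Definition two_cycles (a b : nat) (G : graph) : Prop :=
  exists x s1 s2, [/\ uniq (x :: s1 ++ s2), (size s1).+1 = a, (size s2).+1 = b &
    G = pathG (x :: rcons s1 x) `|` pathG (x :: rcons s2 x)].

Definition fused (p q : nat) (G : graph) : Prop :=
  exists x y s1 s2, [/\ uniq (x :: y :: s1 ++ s2), (size s1).+2 = p, (size s2).+2 = q &
    G = pathG (x :: rcons s1 y) `|` ([fset [fset x; y]] `|` pathG (x :: rcons s2 y))].

Lemma two_cyclesC a b G : two_cycles a b G -> two_cycles b a G.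
Proof.
move=> [x [s1 [s2 [u p q ->]]]]; exists x, s2, s1; split=> //; last by rewrite fsetUC.
move: u; rewrite !cons_uniq !mem_cat orbC => /andP[-> u].
by rewrite uniq_catC.
Qed.

Lemma ear_mem_vertices x s y z : z \in x :: rcons s y -> z \in vertices (pathG (x :: rcons s y)).
Proof. by apply: mem_vertices_pathG; rewrite /= size_rcons. Qed.

Lemma uniq_map_in (D : {fset nat}) (f : nat -> nat) l : {in D &, injective f} ->
  (forall z, z \in l -> z \in D) -> uniq l -> uniq (map f l).
Proof. by move=> fI lD; rewrite map_inj_in_uniq // => a b /lD aD /lD bD; apply: fI. Qed.

Lemma cyc_closed k : iso_closed (cyc k).
Proof.
move=> f G fI [x [s [u sk GE]]]; exists (f x), (map f s).
rewrite size_map GE relabel_pathG /= map_rcons; split=> //.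
apply: (uniq_map_in fI _ u) => z zs; rewrite GE.
by apply: ear_mem_vertices; rewrite -rcons_cons mem_rcons inE zs orbT.
Qed.

Lemma two_cycles_closed a b : iso_closed (two_cycles a b).
Proof.
move=> f G fI [x [s1 [s2 [u s1E s2E GE]]]]; exists (f x), (map f s1), (map f s2).
rewrite !size_map GE relabelU !relabel_pathG /= !map_rcons; split=> //.
rewrite -map_cat; apply: (uniq_map_in fI _ u) => z zs.
rewrite GE verticesU in_fsetU; move: zs; rewrite -cat_cons mem_cat.
case/orP=> zs; apply/orP; [left|right]; apply: ear_mem_vertices.
  by rewrite -rcons_cons mem_rcons inE zs orbT.
by rewrite inE mem_rcons inE zs !orbT.
Qed.

Lemma fused_closed p q : iso_closed (fused p q).
Proof.
move=> f G fI [x [y [s1 [s2 [u s1E s2E GE]]]]]; exists (f x), (f y), (map f s1), (map f s2).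
rewrite !size_map GE !relabelU !relabel_pathG relabel_edge /= !map_rcons; split=> //.
rewrite -map_cat; apply: (uniq_map_in fI _ u) => z zs.
rewrite GE verticesU in_fsetU; apply/orP.
move: zs; rewrite !inE mem_cat => /or4P[/eqP ->|/eqP ->|zs|zs].
- by left; apply: ear_mem_vertices; rewrite inE eqxx.
- by left; apply: ear_mem_vertices; rewrite inE mem_rcons inE eqxx orbT.
- by left; apply: ear_mem_vertices; rewrite inE mem_rcons inE zs !orbT.
right; rewrite verticesU in_fsetU; apply/orP; right.
by apply: ear_mem_vertices; rewrite inE mem_rcons inE zs !orbT.
Qed.

Lemma is_ear_loop x s : uniq (x :: s) -> 1 < size s -> is_ear x s x.
Proof. by rewrite /is_ear cons_uniq => /andP[-> ->] ->; rewrite implybT. Qed.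

Lemma is_ear_open x s y : uniq (x :: y :: s) -> is_ear x s y.
Proof.
rewrite /is_ear !cons_uniq !inE negb_or => /and3P[/andP[/negPf xy ->] -> ->].
by rewrite xy.
Qed.

Lemma cyc_simple k G : 3 <= k -> cyc k G -> simple G.
Proof.
move=> k3 [x [s [u sk ->]]]; apply/simple_ear/is_ear_loop => //.
by rewrite -sk ltnS in k3.
Qed.

Lemma ear_nonempty x s y : exists e, e \in pathG (x :: rcons s y).
Proof.
case: s => [|a s]; [exists [fset x; y]|exists [fset x; a]];
by rewrite /= pathG_cons in_fsetU in_fset1 eqxx.
Qed.

Lemma cyc_nonempty k G : cyc k G -> exists e, e \in G.
Proof. move=> [x [s [_ _ ->]]]; exact: ear_nonempty. Qed.

(** * Options of a cycle and of two cycles sharing a vertex *)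

Definition edgeless : graph -> Prop := eq fset0.

Lemma edgeless_closed : iso_closed edgeless.
Proof. by move=> f G _ <-; rewrite relabel0. Qed.

Lemma pathG_digon x a : pathG [:: x; a; x] = [fset [fset a; x]].
Proof. by rewrite pathG_cons pathG2 fset2C fsetUid. Qed.

Lemma cyc2_pendant G : cyc 2 G -> pendant edgeless 1 G.
Proof.
move=> [x [s [u sE ->]]]; case: s u sE => [|a [|//]] //= u _;
rewrite pathG_digon -[X in pendant _ _ X]fsetU0.
apply: pendantS; rewrite ?vertices0 //; first exact: pendant0.
by move: u; rewrite inE eq_sym andbT.
Qed.

(** A cycle is a closed ear attached to the empty graph. *)
Lemma cyc_options k G e w : 3 <= k -> cyc k G -> e \in G -> w \notin vertices G ->
  pendant edgeless k.-1 (G `\ e) /\ cyc k.-1 (contract w G e).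
Proof.
move=> k3 [x [s [u sk ->]]] eG wG.
have s2 : 1 < size s by rewrite -sk ltnS in k3.
have xsx := is_ear_loop u s2; have s0 : s != [::] by case: (s) s2.
have no z : z \in s -> z \notin vertices fset0 by rewrite vertices0.
split.
  have := pendant_delete_ear xsx s0 no eG; rewrite fsetU0 -sk.
  exact.
rewrite -[pathG _]fsetU0 in wG *.
have [s' [ss' sub cC]] := contract_ear xsx s0 no eG wG.
apply: cC; first exact: cyc_closed.
rewrite fsetU0; exists x, s'; split=> //; last by rewrite ss' -sk.
by apply: subseq_uniq u; rewrite /= eqxx.
Qed.

Lemma two_cycles2_pendant b G : two_cycles 2 b G -> pendant (cyc b) 1 G.
Proof.
move=> [x [s1 [s2 [u s1E sb ->]]]]; case: s1 u s1E => [|a [|//]] //= /and3P[+ as2 u2] _.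
 rewrite inE negb_or => /andP[xa xs2]; rewrite pathG_digon.
apply: pendantS; last by rewrite eq_sym.
  by apply: pendant0; exists x, s2; split=> //=; rewrite xs2.
apply/negP => /vertices_pathG; rewrite inE mem_rcons inE (negPf as2).
by rewrite orbF orbb eq_sym (negPf xa).
Qed.

Lemma two_cycles_simple a b G : 3 <= a -> 3 <= b -> two_cycles a b G -> simple G.
Proof.
move=> a3 b3 [x [s1 [s2 [u sa sb ->]]]]; apply: simpleU; apply/simple_ear/is_ear_loop.
- by apply: subseq_uniq u; rewrite -cat_cons; exact: prefix_subseq.
- by rewrite -sa ltnS in a3.
- by apply: subseq_uniq u; rewrite /= eqxx suffix_subseq.
- by rewrite -sb ltnS in b3.
Qed.

(** The first cycle is a closed ear attached to the second. Moves in the second cycle follow by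
    exchanging the two. *)
Lemma two_cycles_options x s1 s2 e w (G := pathG (x :: rcons s1 x) `|` pathG (x :: rcons s2 x)) :
  uniq (x :: s1 ++ s2) -> 1 < size s1 -> e \in pathG (x :: rcons s1 x) -> w \notin vertices G ->
  pendant (cyc (size s2).+1) (size s1) (G `\ e) /\
  two_cycles (size s1) (size s2).+1 (contract w G e).
Proof.
move=> u ls1 eG wG.
have u1 : uniq (x :: s1) by apply: subseq_uniq u; rewrite -cat_cons; exact: prefix_subseq.
have u2 : uniq (x :: s2) by apply: subseq_uniq u; rewrite /= eqxx suffix_subseq.
have xsx := is_ear_loop u1 ls1; have s0 : s1 != [::] by case: (s1) ls1.
have no z : z \in s1 -> z \notin vertices (pathG (x :: rcons s2 x)).
  move=> zs1; apply/negP => /vertices_pathG; rewrite inE mem_rcons inE orbA orbb => /orP[/eqP zx|zs2].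
    by move: u1; rewrite cons_uniq -zx zs1.
  by move: u; rewrite /= cat_uniq => /and4P[_ _ /hasPn /(_ z zs2)]; rewrite zs1.
split.
  apply: pendant_sub (pendant_delete_ear xsx s0 no eG) => _ <-.
  by exists x, s2.
have [s' [ss' sub cC]] := contract_ear xsx s0 no eG wG.
apply: cC; first exact: two_cycles_closed.
exists x, s', s2; split=> //.
by apply: subseq_uniq u; rewrite /= eqxx; apply: cat_subseq.
Qed.

(** * Options of two cycles sharing an edge *)

Lemma fused2_cyc q G : fused 2 q G -> cyc q G.
Proof.
move=> [x [y [s1 [s2 [u s1E sq ->]]]]]; case: s1 u s1E => [|//] /= /and3P[xy ys u] _.
rewrite pathG2 fsetUA fsetUid; exists y, (x :: s2); split=> //=.
  by move: xy ys; rewrite !inE !negb_or eq_sym u => /andP[-> ->] ->.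
by rewrite pathG_cons fset2C.
Qed.

Lemma ends_notin_ear x s y : is_ear x s y -> s != [::] -> [fset x; y] \notin pathG (x :: rcons s y).
Proof.
move=> /and4P[_ xs ys _] s0; apply/negP => /pathG_edge[A [B [sE eE]]].
have [z] := @ear_internal x y A B ltac:(by rewrite -sE).
by rewrite -sE -eE in_fset2 => zs /orP[] /eqP zE; move: xs ys; rewrite -zE zs.
Qed.

Section FusedOptions.

Variables (x y : nat) (s1 s2 : seq nat).
Hypotheses (u : uniq (x :: y :: s1 ++ s2)) (s10 : s1 != [::]) (s20 : s2 != [::]).

Let G := pathG (x :: rcons s1 y) `|` ([fset [fset x; y]] `|` pathG (x :: rcons s2 y)).

Let u1 : uniq (x :: y :: s1).
Proof. by apply: subseq_uniq u; rewrite -!cat_cons; exact: prefix_subseq. Qed.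

Let u2 : uniq (x :: y :: s2).
Proof. by apply: subseq_uniq u; rewrite /= !eqxx suffix_subseq. Qed.

Lemma fused_simple : simple G.
Proof.
apply: simpleU; [exact/simple_ear/is_ear_open|apply: simpleU; last exact/simple_ear/is_ear_open].
move=> d; rewrite in_fset1 => /eqP ->; exists x, y; split=> //.
by move: u1; rewrite /= inE negb_or => /andP[/andP[]].
Qed.

Lemma fused_shared_delete : G `\ [fset x; y] = pathG (x :: rcons s1 y) `|` pathG (x :: rcons s2 y).
Proof.
apply/fsetP => d; rewrite in_fsetD1 !in_fsetU in_fset1; case: eqVneq => //= ->.
by rewrite (negPf (ends_notin_ear (is_ear_open u1) s10)) (negPf (ends_notin_ear (is_ear_open u2) s20)).
Qed.

(** Without the shared edge the two ears form one cycle, along [s1] and back along [s2]. Contracting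
    that edge closes both ears at [w] and keeps all their internal vertices. *)
Lemma fused_shared_options w : w \notin vertices G ->
  cyc (size s1 + size s2).+2 (G `\ [fset x; y]) /\
  two_cycles (size s1).+1 (size s2).+1 (contract w G [fset x; y]).
Proof.
move=> wG; rewrite /contract fused_shared_delete; split.
  exists x, (s1 ++ y :: rev s2); split.
  - move: u; rewrite !cons_uniq !mem_cat !inE !mem_rev => /and3P[].
    rewrite mem_cat !negb_or => /and3P[xy xs1 xs2] /andP[ys1 ys2] us.
    rewrite xs1 xy xs2 (@perm_uniq _ _ (y :: s1 ++ s2)); first by rewrite /= mem_cat negb_or ys1 ys2.
    by rewrite -cat_rcons -cats1 -catA perm_catCA /= perm_cons perm_cat2l perm_rev.
  - by rewrite size_cat /= size_rev addnS.
  rewrite rcons_cat /= -cat_cons pathG_cat rcons_cons.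
  by rewrite -[in LHS](pathG_rev (x :: rcons s2 y)) rev_cons rev_rcons.
have fx : identify [fset x; y] w x = w by rewrite /identify fset21.
have fy : identify [fset x; y] w y = w by rewrite /identify fset22.
have fs z : z \in s1 ++ s2 -> identify [fset x; y] w z = z.
  move=> zs; rewrite /identify in_fset2 ifN //; apply/norP; split.
    by apply: contraTneq zs => ->; move: u; rewrite cons_uniq inE negb_or => /andP[/andP[]].
  by apply: contraTneq zs => ->; move: u; rewrite /= => /and3P[].
have ms1 : map (identify [fset x; y] w) s1 = s1.
  by apply: map_id_in => z zs; apply: fs; rewrite mem_cat zs.
have ms2 : map (identify [fset x; y] w) s2 = s2.
  by apply: map_id_in => z zs; apply: fs; rewrite mem_cat zs orbT.
rewrite relabelU !relabel_pathG !map_cons !map_rcons fx fy ms1 ms2.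
exists w, s1, s2; split=> //; rewrite cons_uniq; apply/andP; split; last by move: u => /and3P[].
move: wG; apply: contra; rewrite !verticesU !in_fsetU mem_cat => /orP[] ws.
  by rewrite ear_mem_vertices // inE mem_rcons inE ws !orbT.
by rewrite [X in _ || (_ || X)]ear_mem_vertices ?orbT // inE mem_rcons inE ws !orbT.
Qed.

(** The first ear is attached to the cycle made of the shared edge and the second ear. *)
Lemma fused_ear_options e w : e \in pathG (x :: rcons s1 y) -> w \notin vertices G ->
  pendant (cyc (size s2).+2) (size s1) (G `\ e) /\
  fused (size s1).+1 (size s2).+2 (contract w G e).
Proof.
move=> eG wG; have xsy := is_ear_open u1.
have no z : z \in s1 -> z \notin vertices ([fset [fset x; y]] `|` pathG (x :: rcons s2 y)).
  move=> zs1; move: u; rewrite /= inE !mem_cat !negb_or cat_uniq.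
  move=> /and3P[/and3P[xy xs1 xs2] /andP[ys1 ys2] /and3P[_ /hasPn h _]].
  have zx : z != x by apply: contraNneq xs1 => <-.
  have zy : z != y by apply: contraNneq ys1 => <-.
  rewrite verticesU vertices_edge in_fsetU in_fset2 (negPf zx) (negPf zy) /=.
  apply/negP => /vertices_pathG; rewrite inE mem_rcons inE (negPf zx) (negPf zy) /= => /h.
  by rewrite zs1.
split.
  apply: pendant_sub (pendant_delete_ear xsy s10 no eG) => _ <-.
  (* That cycle is a fused pair whose first ear is the shared edge itself. *)
  by apply: fused2_cyc; exists x, y, [::], s2; rewrite pathG2 fsetUA fsetUid.
have [s' [ss' sub cC]] := contract_ear xsy s10 no eG wG.
apply: cC; first exact: fused_closed.
exists x, y, s', s2; split=> //; last by rewrite ss'.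
by apply: subseq_uniq u; rewrite /= !eqxx; apply: cat_subseq.
Qed.

End FusedOptions.

(** * Values of forests and of cycles with pendant edges *)

(** This replaces [contract_edge] by [contract] with an arbitrary fresh [w], the form in which the
    options above are described. *)
Lemma nim_value_simple (G : graph) (s : seq nat) : simple G ->
  (forall e w, e \in G -> w \notin vertices G ->
     nim_value (G `\ e) \in s /\ nim_value (contract w G e) \in s) ->
  (forall m, m \in s -> exists2 e, e \in G & forall w, w \notin vertices G ->
     nim_value (G `\ e) = m \/ nim_value (contract w G e) = m) ->
  nim_value G = mex s.
Proof.
move=> sG Gs sG'; have fr := fresh_vertexN G; apply: nim_value_mex => [e eG|m ms].
  by rewrite contract_edgeE //; apply: Gs.
have [e eG eE] := sG' m ms; exists e => //.
by rewrite contract_edgeE //; apply: eE.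
Qed.

Lemma forest_value n G : pendant edgeless n G -> nim_value G = odd n.
Proof.
have se H : edgeless H -> simple H by move=> <- d; rewrite in_fset0.
elim: n G => [|n IH] G FG.
  by inversion FG as [H HE|]; subst; rewrite -HE /nim_value cardfs0.
have opt e w : e \in G -> w \notin vertices G ->
    pendant edgeless n (G `\ e) /\ pendant edgeless n (contract w G e).
  move=> eG wG.
  (* The base has no edges, so its options may be placed in the empty class; only moves on pendant
     edges survive. *)
  have oE H e' w' : edgeless H -> e' \in H -> w' \notin vertices H ->
      pendant (fun _ => False) 0 (H `\ e') /\ pendant (fun _ => False) 0 (contract w' H e').
    by move=> <-; rewrite in_fset0.
  have [[_ ? ?]|[FF _]] := pendant_options edgeless_closed oE FG eG wG; first by [].
  by exfalso; elim: FF.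
rewrite (@nim_value_simple G [:: nat_of_bool (odd n)]); first by rewrite /=; case: (odd n).
- exact: pendant_simple FG.
- by move=> e w eG wG; have [/IH -> /IH ->] := opt e w eG wG; rewrite inE eqxx.
move=> m; rewrite inE => /eqP ->; have [e eG /IH eE] := pendant_leaf_option FG.
by exists e => // w _; left.
Qed.

(** With [t] pendant edges only three values can arise: [d t] and [c t] from deletion and
    contraction in the base, and the value for [t - 1] from a move on a pendant edge. Induction on
    [t] reduces the claim to the numerical recursion for [v]. *)
Lemma pendant_value (B B1 B2 : graph -> Prop) n1 n2 (d c v : nat -> nat) :
  iso_closed B ->
  (forall G, B G -> simple G) ->
  (forall G, B G -> exists e, e \in G) ->
  (forall G e w, B G -> e \in G -> w \notin vertices G ->
     pendant B1 n1 (G `\ e) /\ pendant B2 n2 (contract w G e)) ->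
  (forall t G, pendant B1 (n1 + t) G -> nim_value G = d t) ->
  (forall t G, pendant B2 (n2 + t) G -> nim_value G = c t) ->
  (forall t, v t = mex (d t :: c t :: if t is t'.+1 then [:: v t'] else [::])) ->
  forall t G, pendant B t G -> nim_value G = v t.
Proof.
move=> cB sB neB oB dE cE vE; elim=> [|t IH] G BG;
rewrite vE; apply: nim_value_simple => [|e w eG wG|m].
- exact: pendant_simple BG.
- case: (pendant_options cB oB BG eG wG) => [[]|[/dE -> /cE ->]] //.
  by rewrite !inE !eqxx orbT.
- have [e eG eE] := pendant_base_option oB neB BG; rewrite !inE => mdc.
  exists e => // w /eE[/dE -> /cE ->].
  by case/orP: mdc => /eqP ->; [left|right].
- exact: pendant_simple BG.
- case: (pendant_options cB oB BG eG wG) => [[_ /IH -> /IH ->]|[/dE -> /cE ->]].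
    by rewrite !inE !eqxx !orbT.
  by rewrite !inE !eqxx !orbT.
rewrite !inE orbA => /orP[mdc|/eqP ->].
  have [e eG eE] := pendant_base_option oB neB BG.
  exists e => // w /eE[/dE -> /cE ->].
  by case/orP: mdc => /eqP ->; [left|right].
have [e eG /IH eE] := pendant_leaf_option BG.
by exists e => // w _; left.
Qed.

(** The value of a [k]-cycle with [t] pendant edges, [k >= 3]. The triangle is exceptional because
    contracting one of its edges merges the other two; forests of both parities are then options. *)
Definition unicyclic_value (k t : nat) : nat :=
  if k == 3 then (odd t).+2 else odd (k + t).

Lemma unicyclic_valueP k t G : 3 <= k -> pendant (cyc k) t G ->
  nim_value G = unicyclic_value k t.
Proof.
move=> k3; rewrite -(subnKC k3); elim: (k - 3) t G => {k k3} [|k IH] t G.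
  (* Deleting an edge of the triangle leaves two edges of it, contracting one leaves a single
     edge. *)
  apply: (@pendant_value _ edgeless edgeless 2 1 (fun t => odd (2 + t))
      (fun t => odd (1 + t))) t G => //.
  - exact: cyc_closed.
  - by move=> G; apply: cyc_simple.
  - exact: cyc_nonempty.
  - by move=> G e w cG eG wG; have [? /cyc2_pendant] := cyc_options (isT : 2 < 3 + 0) cG eG wG.
  - by move=> t G /forest_value.
  - by move=> t G /forest_value.
  by case=> [|t] //; rewrite /unicyclic_value /=; case: (odd t).
rewrite addnS.
apply: (@pendant_value _ edgeless (cyc (3 + k)) (3 + k) 0 (fun t => odd (3 + k + t))
  (fun t => unicyclic_value (3 + k) t)) t G => //.
- exact: cyc_closed.
- by move=> G; apply: cyc_simple.
- exact: cyc_nonempty.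
- move=> G e w cG eG wG; have [? ?] := cyc_options (isT : 2 < (3 + k).+1) cG eG wG.
  by split=> //; apply: pendant0.
- by move=> t G /forest_value.
move=> t; rewrite /unicyclic_value; case: k {IH} => [|k].
  by case: t => [|t] //=; rewrite ?addnS /=; case: (odd t).
case: t => [|t] /=; rewrite ?addnS /= !oddD; case: (odd k) => //; by case: (odd t).
Qed.

(** * Values of two cycles sharing a vertex *)

(* The cases [a = 2] and [b = 2] are the collapsed digons; likewise in [fused_value]. *)
Definition two_cycles_value (a b : nat) : nat :=
  if (a == 2) && (b == 2) then 0
  else if a == 2 then unicyclic_value b 1
  else if b == 2 then unicyclic_value a 1
  else if (a == 3) && (b == 3) then 0
  else if (a == 3) || (b == 3) then (~~ odd (a + b)).+2
  else odd (a + b).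

Lemma two_cycles_valueC a b : two_cycles_value a b = two_cycles_value b a.
Proof.
rewrite /two_cycles_value addnC.
by case: (a == 2); case: (b == 2); case: (a == 3); case: (b == 3).
Qed.

(** The entries come from deletion and contraction in each cycle. Sizes 3 and 4 are split off, as
    shrinking leads them to the exceptional sizes 2 and 3; beyond that only parities matter. *)
Lemma two_cycles_mex a b (e := two_cycles_value) (u := unicyclic_value) : 3 <= a -> 3 <= b ->
  mex [:: u b a.-1; e a.-1 b; u a b.-1; e a b.-1] = e a b.
Proof.
case: a => [|[|[|a]]] // _; case: b => [|[|[|b]]] // _; rewrite {}/e {}/u.
case: a => [|[|a]]; case: b => [|[|b]] //;
rewrite /two_cycles_value /unicyclic_value ?addSn ?addnS /= ?oddD.
all: by try case: (odd a); try case: (odd b).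
Qed.


Lemma two_cycles_valueP a b G : 2 <= a -> 2 <= b -> two_cycles a b G ->
    nim_value G = two_cycles_value a b.
Proof.
have [n] := ubnP (a + b); elim: n a b G => // n IH a b G ltn a2 b2 abG.
(* A digon is one pendant edge on the other cycle; two digons form a forest with two edges. *)
have two k H : 2 <= k -> two_cycles 2 k H -> nim_value H = two_cycles_value 2 k.
  rewrite leq_eqVlt => /orP[/eqP <-|k3] /two_cycles2_pendant HH; last first.
    by rewrite (unicyclic_valueP k3 HH) /two_cycles_value /= (gtn_eqF k3).
  by have /forest_value -> := pendant_trans cyc2_pendant HH.
have [aE|a3] := eqVneq a 2; first by move: abG; rewrite aE; apply: two.
have [bE|b3] := eqVneq b 2.
  by rewrite two_cycles_valueC; move/two_cyclesC: abG; rewrite bE; apply: two.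
have {a2 a3} a3 : 3 <= a by rewrite ltn_neqAle eq_sym a3.
have {b2 b3} b3 : 3 <= b by rewrite ltn_neqAle eq_sym b3.
have sG := two_cycles_simple a3 b3 abG.
have val x s1 s2 : G = pathG (x :: rcons s1 x) `|` pathG (x :: rcons s2 x) ->
    uniq (x :: s1 ++ s2) -> 3 <= (size s1).+1 -> 3 <= (size s2).+1 ->
    (size s1).+1 + (size s2).+1 < n.+1 ->
    forall e w, e \in pathG (x :: rcons s1 x) -> w \notin vertices G ->
    nim_value (G `\ e) = unicyclic_value (size s2).+1 (size s1) /\
    nim_value (contract w G e) = two_cycles_value (size s1) (size s2).+1.
  move=> -> u l1 l2 ln e w eH wH; have [D C] := two_cycles_options u l1 eH wH.
  by split; [exact: unicyclic_valueP D|apply: IH C => //; exact: ltnW].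
rewrite -two_cycles_mex //; case: abG => x [s1 [s2 [u aE bE GE]]].
have u' : uniq (x :: s2 ++ s1).
  by move: u; rewrite !cons_uniq uniq_catC !mem_cat orbC.
have GE' : G = pathG (x :: rcons s2 x) `|` pathG (x :: rcons s1 x) by rewrite fsetUC.
subst a b; have val1 := val _ _ _ GE u a3 b3 ltn.
have val2 := val _ _ _ GE' u' b3 a3 ltac:(by rewrite addnC).
rewrite (two_cycles_valueC _ (size s2)).
apply: nim_value_simple => // [e w + wG|m]; last first.
  have [e1 e1G] := ear_nonempty x s1 x; have [e2 e2G] := ear_nonempty x s2 x.
  rewrite !inE orbA => /orP[mE|mE].
    exists e1 => [|w wG]; first by rewrite GE in_fsetU e1G.
    have [-> ->] := val1 e1 w e1G wG.
    by case/orP: mE => /eqP ->; [left|right].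
  exists e2 => [|w wG]; first by rewrite GE in_fsetU e2G orbT.
  have [-> ->] := val2 e2 w e2G wG.
  by case/orP: mE => /eqP ->; [left|right].
rewrite {1}GE in_fsetU => /orP[/val1 /(_ wG) [-> ->]|/val2 /(_ wG) [-> ->]].
  by rewrite !inE !eqxx !orbT.
by rewrite !inE !eqxx !orbT.
Qed.

(** * Values of two cycles sharing an edge *)

Definition fused_value (p q : nat) : nat :=
  if p == 2 then unicyclic_value q 0
  else if q == 2 then unicyclic_value p 0
  else if (p == 3) && (q == 3) then 1
  else if (p == 3) && (q == 4) || (p == 4) && (q == 3) then 4
  else if (p == 3) || (q == 3) then (odd (p + q)).+2
  else ~~ odd (p + q).

Lemma fused_valueC p q : 3 <= p -> fused_value p q = fused_value q p.
Proof.
move=> p3; rewrite /fused_value addnC gtn_eqF //.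
case: (q == 2); case: (p == 3); case: (q == 3); case: (p == 4); case: (q == 4) => //.
Qed.

(** The entries come in pairs, deletion and contraction, for the shared edge, the first ear and the
    second. For sizes 3 and 4 they cover 0, 1, 2 and 3, whence the value 4; size 5 is split off
    because it shrinks to 4. *)
Lemma fused_mex p q (f := fused_value) (u := unicyclic_value) : 3 <= p -> 3 <= q ->
  mex [:: u (p + q - 2) 0; two_cycles_value p.-1 q.-1; u q (p - 2); f p.-1 q; u p (q - 2); f p q.-1]
  = f p q.
Proof.
case: p => [|[|[|p]]] // _; case: q => [|[|[|q]]] // _; rewrite {}/f {}/u.
case: p => [|[|[|p]]]; case: q => [|[|[|q]]];
rewrite /fused_value /two_cycles_value /unicyclic_value ?addSn ?addnS ?subSS ?subn0 /= ?addn0 ?oddD.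
all: by try case: (odd p); try case: (odd q).
Qed.

Lemma fused_valueP p q G : 3 <= p -> 3 <= q -> fused p q G -> nim_value G = fused_value p q.
Proof.
have [n] := ubnP (p + q); elim: n p q G => // n IH p q G ltn p3 q3 pqG.
have val x y s1 s2 : G = pathG (x :: rcons s1 y) `|`
    ([fset [fset x; y]] `|` pathG (x :: rcons s2 y)) ->
    uniq (x :: y :: s1 ++ s2) -> 3 <= (size s1).+2 -> 3 <= (size s2).+2 ->
    (size s1).+2 + (size s2).+2 < n.+1 ->
    forall e w, e \in pathG (x :: rcons s1 y) -> w \notin vertices G ->
    nim_value (G `\ e) = unicyclic_value (size s2).+2 (size s1) /\
    nim_value (contract w G e) = fused_value (size s1).+1 (size s2).+2.
  move=> -> u l1 l2 ln e w eG wG; have s10 : s1 != [::] by case: (s1) l1.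
  have [D C] := fused_ear_options u s10 eG wG.
  split; first exact: unicyclic_valueP D.
  (* If the ear has one internal vertex, contraction yields a plain cycle, to which the induction
     hypothesis does not apply. *)
  have := l1; rewrite leq_eqVlt => /orP[/eqP [s1E]|l1']; last exact: IH C.
  move: C; rewrite -s1E => /fused2_cyc cC.
  by rewrite (@unicyclic_valueP (size s2).+2 0) //; exact: pendant0.
rewrite -fused_mex //; case: pqG => x [y [s1 [s2 [u pE qE GE]]]].
have u' : uniq (x :: y :: s2 ++ s1).
  by move: u; rewrite !cons_uniq !inE uniq_catC !mem_cat ![(_ \in s1) || _]orbC.
have GE' : G = pathG (x :: rcons s2 y) `|` ([fset [fset x; y]] `|` pathG (x :: rcons s1 y)).
  by rewrite GE fsetUC -fsetUA fsetUCA.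
subst p q; have val1 := val _ _ _ _ GE u p3 q3 ltn.
have val2 := val _ _ _ _ GE' u' q3 p3 ltac:(by rewrite addnC).
have s10 : s1 != [::] by case: (s1) p3.
have s20 : s2 != [::] by case: (s2) q3.
have val0 w : w \notin vertices G ->
    nim_value (G `\ [fset x; y]) = unicyclic_value ((size s1).+2 + (size s2).+2 - 2) 0 /\
    nim_value (contract w G [fset x; y]) = two_cycles_value (size s1).+1 (size s2).+1.
  rewrite GE => wG; have [D C] := fused_shared_options u s10 s20 wG; split.
    rewrite !addSn !addnS !subSS subn0; apply: unicyclic_valueP; last exact: pendant0.
    by apply: leq_trans p3 _; rewrite !ltnS leq_addr.
  exact: two_cycles_valueP C.
rewrite !succnK (_ : (size s1).+2 - 2 = size s1); last by rewrite !subSS subn0.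
rewrite (_ : (size s2).+2 - 2 = size s2); last by rewrite !subSS subn0.
rewrite (@fused_valueC (size s1).+2) //.
have e0G : [fset x; y] \in G by rewrite GE !in_fsetU in_fset1 eqxx orbT.
have [e1 e1G] := ear_nonempty x s1 y; have [e2 e2G] := ear_nonempty x s2 y.
apply: nim_value_simple => [|e w + wG|m].
- by rewrite GE; apply: fused_simple.
- rewrite {1}GE !in_fsetU in_fset1.
  case/or3P=> [/val1 /(_ wG) [-> ->]|/eqP ->|/val2 /(_ wG) [-> ->]].
  + by rewrite !inE !eqxx !orbT.
  + by have [-> ->] := val0 w wG; rewrite !inE !eqxx !orbT.
  by rewrite !inE !eqxx !orbT.
rewrite !inE => mE.
(* The values are grouped by the edge that attains them: the shared edge, an edge of the first ear,
   an edge of the second. *)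
have {mE} [mE|mE|mE] : [\/ (m == unicyclic_value ((size s1).+2 + (size s2).+2 - 2) 0) ||
    (m == two_cycles_value (size s1).+1 (size s2).+1),
    (m == unicyclic_value (size s2).+2 (size s1)) || (m == fused_value (size s1).+1 (size s2).+2) |
    (m == unicyclic_value (size s1).+2 (size s2)) || (m == fused_value (size s2).+1 (size s1).+2)].
  by case/orP: mE => [h|/or4P[h|h|h|/orP[]h]]; rewrite h ?orbT;
    [apply: Or31|apply: Or31|apply: Or32|apply: Or32|apply: Or33|apply: Or33].
- exists [fset x; y] => // w /val0[-> ->].
  by case/orP: mE => /eqP ->; [left|right].
- exists e1 => [|w wG]; first by rewrite GE in_fsetU e1G.
  have [-> ->] := val1 e1 w e1G wG.
  by case/orP: mE => /eqP ->; [left|right].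
exists e2 => [|w wG]; first by rewrite GE !in_fsetU e2G !orbT.
have [-> ->] := val2 e2 w e2G wG.
by case/orP: mE => /eqP ->; [left|right].
Qed.

(** * The graphs [FC p q] *)

Lemma FC_fused p q : 3 <= p -> 3 <= q -> fused p q (FC p q).
Proof.
(* Each cycle starts with the edge from 0 to 1, so the rest of it is an ear from 1 back to 0. The
   internal vertices of the two ears are consecutive intervals. *)
move=> p3 q3; exists 1, 0, (iota 2 (p - 2)), (iota p (q - 2)); split.
- have {2}-> : p = 2 + (p - 2) by rewrite subnKC // ltnW.
  by rewrite -iotaD /= inE !mem_iota iota_uniq.
- by rewrite size_iota -addn2 subnK // ltnW.
- by rewrite size_iota -addn2 subnK // ltnW.
rewrite /FC !cycle_graphE /= !(pathG_cons 0) [[fset 1; 0]]fset2C.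
by rewrite -fsetUA fsetUCA; congr fsetU; rewrite fsetUA fsetUid.
Qed.

Theorem theorem2 :
  nim_value (FC 3 3) = 1 /\
  nim_value (FC 3 4) = 4 /\
  (forall q : nat, 5 <= q -> odd q -> nim_value (FC 3 q) = 2) /\
  (forall q : nat, 6 <= q -> ~~ odd q -> nim_value (FC 3 q) = 3) /\
  (forall p q : nat, 4 <= p -> p <= q ->
     nim_value (FC p q) = (if odd (p + q) then 0 else 1)).
Proof.
have val p q : 3 <= p -> 3 <= q -> nim_value (FC p q) = fused_value p q.
  by move=> p3 q3; exact/fused_valueP/FC_fused.
split; first by rewrite val.
split; first by rewrite val.
split=> [q q5 oq|].
  rewrite val //; last by rewrite ltnW // ltnW.
  by case: q q5 oq => [|[|[|[|[|q]]]]] // _; rewrite /fused_value /=; case: (odd q).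
split=> [q q6 oq|p q p4 pq].
  rewrite val //; last by do 3 apply: ltnW.
  by case: q q6 oq => [|[|[|[|[|q]]]]] // _; rewrite /fused_value /=; case: (odd q).
have q4 := leq_trans p4 pq; rewrite val; [|exact: ltnW..].
by case: p p4 pq => [|[|[|[|p]]]] // _ _;
case: q q4 => [|[|[|[|q]]]] // _; rewrite /fused_value /= andbF; case: odd.
Qed.
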